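(* 1. For every graph $F$, $W_{\mathrm{tw}}(F)\ge v(F_0)$, where $F_0$ is the core of $F$. 2. For every connected graph $F$, $W_{\mathrm{tw}}(F)\ge \mathrm{tw}(F)+1$, except in the case that $F$ is a subtree of some megastar $M_{3,b}$.
   Context: Graphs are finite simple graphs; $v(F)$ is the number of vertices and $\mathrm{tw}(F)$ the treewidth. We use first-order logic of graphs with relation symbols for adjacency and equality only; the variable width of a sentence is the number of distinct variables it uses. $W_{\mathrm{tw}}(F)$ is the minimum variable width of a first-order sentence $\Phi$ for which there is an integer $k$ such that for every connected graph $G$ with $\mathrm{tw}(G)\ge k$, $G\models\Phi$ if and only if $G$ contains a (not necessarily induced) subgraph isomorphic to $F$. The core $F_0$ of $F$ is the graph obtained from $F$ by removing, consecutively and as long as possible, vertices of degree at most 1 (it is empty if $F$ is a forest). The megastar $M_{s,t}$ is obtained from the star $K_{1,s}$ by subdividing each edge into a path with $t+1$ vertices (so $v(M_{s,t})=st+1$). *)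

(* Defs.v *)
From mathcomp Require Import all_boot.
From mathcomp Require Import boolp.

Set Implicit Arguments.
Unset Strict Implicit.
Unset Printing Implicit Defensive.

Record sgraph := SGraph {
  vert :> finType;
  adj : rel vert;
  adj_sym : symmetric adj;
  adj_irr : irreflexive adj }.
Arguments adj {s}.

Definition nverts (G : sgraph) := #|G|.

Definition connected (G : sgraph) : Prop :=
  (0 < #|G|) /\ forall x y : G, connect (@adj G) x y.

Definition acyclic (G : sgraph) : Prop :=
  ~ exists c : seq G, [/\ 2 < size c, uniq c & cycle (@adj G) c].

Definition is_tree (G : sgraph) : Prop := connected G /\ acyclic G.

Definition contains (G F : sgraph) : Prop :=
  exists f : F -> G, injective f /\ forall x y : F, adj x y -> adj (f x) (f y).

Record tdec (G : sgraph) := TDec {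
  td_tree : sgraph;
  td_bag : td_tree -> {set G};
  td_is_tree : is_tree td_tree;
  td_cover : forall v : G, exists i, v \in td_bag i;
  td_edge : forall x y : G, adj x y -> exists i, (x \in td_bag i) && (y \in td_bag i);
  td_conn : forall (v : G) (i j : td_tree), v \in td_bag i -> v \in td_bag j ->
      connect [rel a b | [&& adj a b, v \in td_bag a & v \in td_bag b]] i j }.

Definition tw_le (G : sgraph) (k : nat) : Prop :=
  exists D : tdec G, forall i, #|@td_bag G D i| <= k.+1.

Definition unit_graph : sgraph.
Proof.
refine (@SGraph unit [rel _ _ | false] _ _); by [].
Defined.

Lemma unit_graph_tree : is_tree unit_graph.
Proof.
split.
  split; first by rewrite card_unit.
  by move=> [] []; exact: connect0.
move=> [c [Hs Hu _]].
have := uniq_leq_size (s1 := c) (s2 := enum unit_graph) Hu.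
move=> H; have : size c <= size (enum unit_graph).
  apply: H => x _; by rewrite mem_enum.
rewrite -cardE /= card_unit => Hc.
by move: (leq_trans Hs Hc).
Qed.


Definition tw_le_card_ex (G : sgraph) : exists k, `[< tw_le G k >].
Proof.
exists #|G|; apply/asboolP.
have D : tdec G.
  apply: (@TDec G unit_graph (fun _ => setT)).
  - exact: unit_graph_tree.
  - by move=> v; exists tt; rewrite inE.
  - by move=> x y _; exists tt; rewrite !inE.
  - by move=> v [] [] _ _; exact: connect0.
exists D => i; apply: leq_trans (max_card _) _; exact: leqnSn.
Qed.

Definition treewidth (G : sgraph) : nat := ex_minn (tw_le_card_ex G).

Definition deg_in (G : sgraph) (S : {set G}) (x : G) : nat :=
  #|[set y in S | adj x y]|.

Definition peel_step (G : sgraph) : rel {set G} :=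
  fun S S' => [exists x in S, (deg_in S x <= 1) && (S' == S :\ x)].

Definition is_core (G : sgraph) (S : {set G}) : Prop :=
  connect (@peel_step G) setT S /\ (forall x, x \in S -> 1 < deg_in S x).

Definition mstar_adj (s t : nat) : rel (option ('I_s * 'I_t)) :=
  fun u v => match u, v with
  | None, Some (_, j) => nat_of_ord j == 0
  | Some (_, j), None => nat_of_ord j == 0
  | Some (i, j), Some (i', j') =>
      (i == i') && ((j.+1 == j' :> nat) || (j'.+1 == j :> nat))
  | None, None => false
  end.

Lemma mstar_adj_sym (s t : nat) : symmetric (@mstar_adj s t).
Proof.
move=> [[i j]|] [[i' j']|] //=.
by rewrite eq_sym orbC.
Qed.

Lemma mstar_adj_irr (s t : nat) : irreflexive (@mstar_adj s t).
Proof.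
move=> [[i j]|] //=; rewrite eqxx /=.
by rewrite eq_sym (ltn_eqF (ltnSn j)).
Qed.

(* M_{s,t}: the star K_{1,s} with each edge subdivided into a path with
   t+1 vertices; vertex None is the centre, Some (i, j) is the (j+1)-th
   vertex of the i-th arm (j = 0 adjacent to the centre). *)
Definition megastar (s t : nat) : sgraph :=
  @SGraph (option ('I_s * 'I_t)) (@mstar_adj s t)
    (@mstar_adj_sym s t) (@mstar_adj_irr s t).

Definition subtree_of_M3 (F : sgraph) : Prop :=
  is_tree F /\ exists b, contains (megastar 3 b) F.

Inductive form :=
  | FEq  of nat & nat
  | FAdj of nat & nat
  | FNot of form
  | FAnd of form & form
  | FOr  of form & form
  | FEx  of nat & form
  | FAll of nat & form.

Fixpoint sat (G : sgraph) (a : nat -> G) (f : form) : Prop :=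
  match f with
  | FEq x y => a x = a y
  | FAdj x y => adj (a x) (a y)
  | FNot g => ~ sat a g
  | FAnd g h => sat a g /\ sat a h
  | FOr g h => sat a g \/ sat a h
  | FEx x g => exists v : G, sat (fun z => if z == x then v else a z) g
  | FAll x g => forall v : G, sat (fun z => if z == x then v else a z) g
  end.

Fixpoint free_vars (f : form) : seq nat :=
  match f with
  | FEq x y | FAdj x y => [:: x; y]
  | FNot g => free_vars g
  | FAnd g h | FOr g h => free_vars g ++ free_vars h
  | FEx x g | FAll x g => filter (fun z => z != x) (free_vars g)
  end.

Fixpoint all_vars (f : form) : seq nat :=
  match f with
  | FEq x y | FAdj x y => [:: x; y]
  | FNot g => all_vars g
  | FAnd g h | FOr g h => all_vars g ++ all_vars h
  | FEx x g | FAll x g => x :: all_vars g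
  end.

Definition sentence (f : form) : bool := nilp (free_vars f).

Definition var_width (f : form) : nat := size (undup (all_vars f)).

Definition models (G : sgraph) (f : form) : Prop := forall a : nat -> G, sat a f.

Definition tw_defines (F : sgraph) (Phi : form) : Prop :=
  sentence Phi /\
  exists k, forall G : sgraph, connected G -> k <= treewidth G ->
    (models G Phi <-> contains G F).

Definition Wtw_ge (F : sgraph) (m : nat) : Prop :=
  forall Phi, tw_defines F Phi -> m <= var_width Phi.

(* Main.v *)
Require Import Defs.
From mathcomp Require Import fingroup perm all_boot.
From mathcomp Require Import boolp zify.

(* 1. Let l be the size of the core and let A be a connected graph of large minimum
   degree (hence of large treewidth) whose girth exceeds v(F).  Glue a copy of A by
   its root to every vertex of K_l, respectively of K_(l-1).  The first graph
   contains F: place the core on the clique and attach the peeled vertices greedily.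
   The second does not: a cycle on at most v(F) vertices lives in the clique, hence
   so would the core.  With l-1 variables the two graphs are indistinguishable,
   since l-2 pebbles always leave a free clique vertex on both sides.
   2. If the core is nonempty, then tw(F) + 1 <= v(F_0) and 1. applies.  Otherwise F
   is a tree, tw(F) <= 1, and a sentence with one variable has the same value in all
   nonempty graphs; but K_n contains F, whereas a sufficiently subdivided cubic graph
   with a large clique minor contains no trees on v(F) vertices except subtrees of
   M_(3,b). *)

Set Implicit Arguments.
Unset Strict Implicit.
Unset Printing Implicit Defensive.

Lemma leq_card_inj_in (T U : finType) (f : T -> U) (A : {pred T}) (B : {pred U}) :
  {in A &, injective f} -> {in A, forall x, f x \in B} -> #|A| <= #|B|.
Proof.
move=> f_inj fAB; rewrite -(card_in_imset f_inj).
by apply/subset_leq_card/subsetP=> _ /imsetP[x xA ->]; apply: fAB.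
Qed.

(** * Connectivity *)

Lemma connect_ind (T : finType) (e : rel T) (P : T -> Prop) (x : T) :
  P x -> (forall y z, P y -> e y z -> P z) -> forall y, connect e x y -> P y.
Proof.
move=> Px step y /connectP[p]; elim: p x Px => [|z p IH] x Px /=; first by move=> _ ->.
by move=> /andP[xz] /IH; apply; apply: step xz.
Qed.

Lemma connect_homo (T U : finType) (e : rel T) (e' : rel U) (f : T -> U) :
    (forall x y, e x y -> connect e' (f x) (f y)) ->
  forall x y, connect e x y -> connect e' (f x) (f y).
Proof.
move=> step x; apply: connect_ind => [|y z xy yz]; first exact: connect0.
exact: connect_trans xy (step _ _ yz).
Qed.

Lemma adj_neq (G : sgraph) (x y : G) : adj x y -> x != y.
Proof. by apply: contraTneq => ->; rewrite adj_irr. Qed.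

Section InducedAdjacency.

Variables (G : sgraph) (P : pred G).

Definition adj_in : rel G := [rel x y | [&& adj x y, P x & P y]].

Definition connected_on : Prop := forall x y, P x -> P y -> connect adj_in x y.

Lemma connect_adj_in_sym : connect_sym adj_in.
Proof.
by apply: sym_connect_sym => x y; rewrite /adj_in /= adj_sym [P x && _]andbC.
Qed.

End InducedAdjacency.

Lemma connect_adj_in_sub (G : sgraph) (P Q : pred G) :
  subpred P Q -> subrel (connect (adj_in P)) (connect (adj_in Q)).
Proof.
move=> PQ; apply: connect_sub => x y /and3P[xy Px Py].
by apply: connect1; rewrite /adj_in /= xy !PQ.
Qed.

Lemma connect_adj_in (G : sgraph) (P : pred G) :
  subrel (connect (adj_in P)) (connect adj).
Proof. by apply: connect_sub => x y /and3P[xy _ _]; apply: connect1. Qed.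

Lemma eq_connected_on (G : sgraph) (P Q : pred G) :
  P =1 Q -> connected_on P -> connected_on Q.
Proof.
move=> PQ cP x y; rewrite -!PQ => Px Py; apply: connect_adj_in_sub (cP x y Px Py).
by move=> z; rewrite PQ.
Qed.

(** * Degrees, cycles and leaves *)

Definition min_degree_geq (G : sgraph) (d : nat) : Prop :=
  forall x : G, d <= #|adj x|.

Lemma deg_in_setT (G : sgraph) (x : G) : deg_in setT x = #|adj x|.
Proof. by rewrite /deg_in; apply: eq_card => y; rewrite !inE. Qed.

Lemma deg_in_lt_card (G : sgraph) (S : {set G}) x : x \in S -> deg_in S x < #|S|.
Proof.
move=> xS; apply: proper_card; apply/properP; split; first by rewrite setIdE subsetIl.
by exists x; rewrite // inE adj_irr andbF.
Qed.

Definition is_cycle (G : sgraph) (c : seq G) : bool :=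
  [&& 2 < size c, uniq c & cycle adj c].

Definition has_cycle_in (G : sgraph) (S : {set G}) : Prop :=
  exists2 c, is_cycle c & {subset c <= S}.

Definition girth_gt (G : sgraph) (g : nat) : Prop :=
  forall c : seq G, is_cycle c -> g < size c.

Lemma acyclicE (G : sgraph) : acyclic G <-> ~ has_cycle_in [set: G].
Proof.
split=> acG [c]; first by case/and3P=> c3 uc cc _; apply: acG; exists c.
by case=> c3 uc cc; apply: acG; exists c; [apply/and3P | move=> x; rewrite inE].
Qed.

Lemma is_cycle_map (G H : sgraph) (f : G -> H) (c : seq G) :
    injective f -> (forall x y, adj (f x) (f y) = adj x y) ->
  is_cycle (map f c) = is_cycle c.
Proof.
move=> f_inj f_adj; rewrite /is_cycle size_map (map_inj_uniq f_inj) cycle_map.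
by congr [&& _, _ & _]; apply: eq_cycle => x y /=.
Qed.

Lemma girth_no_cycle_in (G : sgraph) (g : nat) (S : {set G}) :
  girth_gt G g -> #|S| <= g -> ~ has_cycle_in S.
Proof.
move=> gG Sg [c cyc cS]; have /and3P[_ uc _] := cyc.
have : size c <= #|S| by rewrite -(card_uniqP uc) subset_leq_card //; apply/subsetP.
by rewrite leqNgt (leq_ltn_trans Sg) ?gG.
Qed.

Lemma deg_in_cycle (G : sgraph) (S : {set G}) c x :
  is_cycle c -> {subset c <= S} -> x \in c -> 1 < deg_in S x.
Proof.
move=> cyc cS /rot_to[i p cE]; have {}cS y : y \in x :: p -> y \in S.
  by rewrite -cE mem_rot; apply: cS.
move: cyc; rewrite /is_cycle -(size_rot i) -(rot_uniq i) -(rot_cycle i) cE.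
case: p cS {cE} => [|a [|b p]] // cS /and3P[_ /and3P[_ ap _]] /= /andP[xa].
rewrite rcons_path => /and3P[_ _ lx]; apply/card_gt1P; exists a, (last b p).
rewrite !inE xa adj_sym lx !cS ?inE ?mem_last ?eqxx ?orbT //.
  by split=> //; apply: contraNneq ap => ->; apply: mem_last.
by have := mem_last b p; rewrite inE => /orP[]->; rewrite ?orbT.
Qed.

Lemma has_cycle_in_del (G : sgraph) (S : {set G}) x :
  deg_in S x <= 1 -> has_cycle_in S -> has_cycle_in (S :\ x).
Proof.
move=> dx [c cyc cS]; exists c => // y yc; rewrite !inE cS // andbT.
by apply: contraTneq dx => <-; rewrite -ltnNge (deg_in_cycle cyc).
Qed.

Lemma cycle_of_chord (G : sgraph) (x y z : G) p :
    path adj x (y :: p) -> uniq [:: x, y & p] -> z \in p -> adj x z ->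
  has_cycle_in [set t in [:: x, y & p]].
Proof.
move=> xp up zp; case/splitPr: zp xp up => q s; rewrite -cat_rcons -cat_cons.
set c := y :: rcons _ _.
rewrite cat_path -cat_cons cat_uniq => /andP[xq _] /andP[uq _] xz.
exists (x :: c) => [|t tc]; last by rewrite in_set mem_cat tc.
by rewrite /is_cycle uq (cycle_path x) /= last_rcons size_rcons adj_sym xz.
Qed.

Definition simple_path_in (G : sgraph) (S : {set G}) (p : seq G) : bool :=
  [&& sorted adj p, uniq p & p \subset S].

Lemma simple_path_in_rev (G : sgraph) (S : {set G}) p :
  simple_path_in S (rev p) = simple_path_in S p.
Proof.
rewrite /simple_path_in rev_sorted rev_uniq (eq_subset (mem_rev p)).
by congr (_ && _); apply: eq_sorted => x y; apply: adj_sym.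
Qed.

Lemma longest_path_in (G : sgraph) (S : {set G}) p : simple_path_in S p ->
  exists2 q, simple_path_in S q && (size p <= size q) &
    forall q', simple_path_in S q' -> size q' <= size q.
Proof.
move=> pS; pose lengths n := `[< exists2 q, simple_path_in S q & size q = n >].
have exl : exists n, lengths n by exists (size p); apply/asboolP; exists p.
have bound n : lengths n -> n <= #|G|.
  by move=> /asboolP[q /and3P[_ /card_uniqP <- _] <-]; apply: max_card.
case: (ex_maxnP exl bound) => n /asboolP[q qS <-] qmax.
have max q' : simple_path_in S q' -> size q' <= size q.
  by move=> q'S; apply: qmax; apply/asboolP; exists q'.
by exists q; rewrite ?qS ?max.
Qed.

Lemma longest_path_off (G : sgraph) (S : {set G}) (r : G) p :
    simple_path_in S p -> 1 < size p ->
  exists u v q, [/\ u != r, simple_path_in S [:: u, v & q] &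
    forall q', simple_path_in S q' -> size q' <= size [:: u, v & q]].
Proof.
move=> pS p2; have [q /andP[qS /(leq_trans p2)]] := longest_path_in pS.
case: q qS => [|u [|v q]] // qS _ qmax.
have [ur|ur] := eqVneq u r; last by exists u, v, q.
have : last u (rev [:: u, v & q]) = u by rewrite rev_cons last_rcons.
move: qS qmax; rewrite -simple_path_in_rev; have := size_rev [:: u, v & q].
case: (rev _) => [|u' [|v' q']] // szq qS qmax /= lu.
exists u', v', q'; split=> // [|w /qmax/leq_trans]; last by apply; apply: eq_leq.
have /and3P[_ /andP[uq' _] _] := qS.
by apply: contraNneq uq' => ->; rewrite -ur -lu mem_last.
Qed.

(* All neighbours of an endpoint of a longest path lie on the path. *)
Lemma longest_path_has_cycle (G : sgraph) (S : {set G}) u v p :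
    simple_path_in S [:: u, v & p] ->
    (forall q, simple_path_in S q -> size q <= size [:: u, v & p]) ->
  1 < deg_in S u -> has_cycle_in S.
Proof.
move=> pS pmax du; have /and3P[pp up /subsetP pSub] := pS.
have [z zS /andP[uz zv]] : exists2 z, z \in S & adj u z && (z != v).
  have /card_gt1P[a [b []]] := du; rewrite !inE => /andP[aS ua] /andP[bS ub].
  have [->|av _] := eqVneq a v; last by exists a; rewrite // ua.
  by rewrite eq_sym => bv; exists b; rewrite // ub.
have : z \in [:: u, v & p].
  apply: contraT => zp; have : simple_path_in S [:: z, u, v & p].
    rewrite /simple_path_in /= adj_sym uz (negPf zp) /=; move: pp up => /= -> -> /=.
    by apply/subsetP=> t; rewrite inE => /predU1P[->|/pSub].
  by move/pmax; rewrite /= ltnn.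
rewrite !inE (negPf zv) eq_sym (negPf (adj_neq uz)) => zp.
have [c cyc cp] := cycle_of_chord pp up zp uz; exists c => // t /cp.
by rewrite inE => /pSub.
Qed.

Lemma min_degree_has_cycle (G : sgraph) (S : {set G}) (r x : G) :
    x \in S -> x != r -> {in S, forall y, y != r -> 1 < deg_in S y} ->
  has_cycle_in S.
Proof.
move=> xS xr Sdeg; have /card_gt0P[y] := ltnW (Sdeg x xS xr).
rewrite inE => /andP[yS xy].
have xyS : simple_path_in S [:: x; y].
  rewrite /simple_path_in /= xy inE (adj_neq xy) /=.
  by apply/subsetP=> z; rewrite !inE => /orP[]/eqP ->.
have [u [v [p [ur pS pmax]]]] := longest_path_off r xyS isT.
apply: (longest_path_has_cycle pS pmax); apply: Sdeg ur.
by have /and3P[_ _ /subsetP] := pS; apply; rewrite inE eqxx.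
Qed.

Lemma acyclic_leaf (G : sgraph) (S : {set G}) :
  acyclic G -> S != set0 -> exists2 x, x \in S & deg_in S x <= 1.
Proof.
move=> /acyclicE acG /set0Pn[x xS]; apply: contrapT => noleaf.
have Sdeg y : y \in S -> 1 < deg_in S y.
  by move=> yS; rewrite ltnNge; apply/negP=> dy; apply: noleaf; exists y.
have /card_gt0P[y] := ltnW (Sdeg x xS); rewrite inE => /andP[_ xy].
have [z zS _|c cyc _] := min_degree_has_cycle xS (adj_neq xy); first exact: Sdeg.
by apply: acG; exists c => // z; rewrite inE.
Qed.

(** * Tree decompositions *)

Definition decomposes (G T : sgraph) (S : {set G}) (bag : T -> {set G}) : Prop :=
  [/\ forall i, bag i \subset S,
      {in S, forall v, exists i, v \in bag i},
      {in S &, forall x y, adj x y -> exists i, (x \in bag i) && (y \in bag i)} &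
      forall v, connected_on (fun i => v \in bag i)].

Definition tw_le_on (G : sgraph) (S : {set G}) (k : nat) : Prop :=
  exists (T : sgraph) (bag : T -> {set G}),
    [/\ is_tree T, decomposes S bag & forall i, #|bag i| <= k.+1].

Lemma tw_leE (G : sgraph) (k : nat) : tw_le G k <-> tw_le_on [set: G] k.
Proof.
split=> [[D szD]|[T [bag [treeT [_ cov edg con] szb]]]].
  exists (td_tree D), (@td_bag G D); split=> //; first exact: td_is_tree.
  split=> [i|v _|x y _ _|v]; [exact: subsetT|exact: td_cover|exact: td_edge|].
  by move=> i j; apply: td_conn.
have cov' v : exists i, v \in bag i by apply: cov.
have edg' x y : adj x y -> exists i, (x \in bag i) && (y \in bag i) by apply: edg.
by exists (TDec treeT cov' edg' con).
Qed.

Lemma leq_treewidth (G : sgraph) (k : nat) :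
  (forall j, tw_le G j -> k <= j) -> k <= treewidth G.
Proof. by rewrite /treewidth; case: ex_minnP => m /asboolP mG _; apply. Qed.

Lemma treewidth_leq (G : sgraph) (k : nat) : tw_le G k -> treewidth G <= k.
Proof.
by move=> Gk; rewrite /treewidth; case: ex_minnP => m _; apply; apply/asboolP.
Qed.

Lemma tw_le_on_card (G : sgraph) (S : {set G}) k : #|S| <= k.+1 -> tw_le_on S k.
Proof.
move=> Sk; exists unit_graph, (fun _ => S); split=> //; first exact: unit_graph_tree.
split=> // [x y xS yS _|v [] [] _ _]; last exact: connect0.
by exists tt; rewrite xS.
Qed.

Definition bag_support (G T : sgraph) (bag : T -> {set G}) : {set T} :=
  [set i | bag i != set0].

Section LeafBag.

Variables (G T : sgraph) (S : {set G}) (bag : T -> {set G}) (t : T).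

Lemma leaf_bagP : bag t != set0 -> deg_in (bag_support bag) t <= 1 ->
  (exists2 v, v \in bag t & forall q, adj t q -> v \notin bag q) \/
  exists p, [/\ adj t p, bag t \subset bag p &
    forall q, adj t q -> bag q != set0 -> q = p].
Proof.
move=> /set0Pn[v vt] dt; have [|allx] := pselect (exists2 x, x \in bag t &
  forall q, adj t q -> x \notin bag q); [by left|right].
have shared x : x \in bag t -> exists2 q, adj t q & x \in bag q.
  move=> xt; apply: contrapT => nq; apply: allx; exists x => // q tq.
  by apply/negP=> xq; apply: nq; exists q.
have [p tp vp] := shared v vt.
have only_p q : adj t q -> bag q != set0 -> q = p.
  move=> tq q0; move/card_le1_eqP: dt; apply; rewrite !inE ?tq ?tp ?andbT //.
  by apply/set0Pn; exists v.
exists p; split=> //; apply/subsetP=> x /[dup] xt /shared[q tq xq].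
by rewrite -(only_p q) //; apply/set0Pn; exists x.
Qed.

Hypothesis dec : decomposes S bag.

Lemma deg_in_lt_bag v :
  v \in bag t -> (forall q, adj t q -> v \notin bag q) -> deg_in S v < #|bag t|.
Proof.
move=> vt vq; have [bagS _ edg con] := dec.
have only i : v \in bag i -> i = t.
  move=> vi; have /connectP[[|q p]] //= := con v t i vt vi.
  by case/andP=> /and3P[/vq/negP].
have vS : v \in S by apply: subsetP vt.
apply: proper_card; apply/properP; split; last by exists v; rewrite // inE adj_irr andbF.
apply/subsetP=> w; rewrite inE => /andP[wS vw].
by have [i /andP[/only -> wi]] := edg v w vS wS vw.
Qed.

Lemma decomposes_drop_leaf p :
    adj t p -> bag t \subset bag p -> (forall q, adj t q -> bag q != set0 -> q = p) ->
  decomposes S (fun i => if i == t then set0 else bag i).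
Proof.
move=> tp /subsetP btp uniqp; have [bagS cov edg con] := dec.
have pt : p == t = false by rewrite eq_sym (negPf (adj_neq tp)).
split=> [i|v vS|x y xS yS xy|v i j].
- by case: ifP; rewrite ?sub0set.
- have [i vi] := cov v vS; have [it|it] := eqVneq i t.
    by exists p; rewrite pt btp // -it.
  by exists i; rewrite (negPf it).
- have [i /andP[xi yi]] := edg x y xS yS xy.
  have [it|it] := eqVneq i t; last by exists i; rewrite (negPf it) xi.
  by exists p; rewrite pt !btp // -it.
case: (eqVneq i t) => it; rewrite ?inE // => vi.
case: (eqVneq j t) => jt; rewrite ?inE // => vj.
set e := adj_in _; pose phi a := if a == t then p else a.
suff step a b : adj_in (fun i => v \in bag i) a b -> connect e (phi a) (phi b).
  by have := connect_homo step (con v i j vi vj); rewrite /phi (negPf it) (negPf jt).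
case/and3P=> ab va vb.
have toward q : v \in bag q -> adj t q -> q = p.
  by move=> vq tq; apply: uniqp => //; apply/set0Pn; exists v.
rewrite /phi; case: (eqVneq a t) (eqVneq b t) => [at_|at_] [bt|bt].
- exact: connect0.
- by rewrite (toward b) // -at_.
- by rewrite (toward a) // adj_sym -bt.
- by apply: connect1; rewrite /e /adj_in /= (negPf at_) (negPf bt) ab va.
Qed.

End LeafBag.

Lemma decomposes_deg_in (G T : sgraph) (S : {set G}) (bag : T -> {set G}) :
    acyclic T -> decomposes S bag -> S != set0 ->
  exists x i, x \in S /\ deg_in S x < #|bag i|.
Proof.
move=> acT + /set0Pn[s sS]; have [n] := ubnP #|bag_support bag|.
elim: n bag => // n IH bag szn dec; have [bagS cov _ _] := dec.
have supp0 : bag_support bag != set0.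
  have [i si] := cov s sS; apply/set0Pn; exists i; rewrite inE.
  by apply/set0Pn; exists s.
have [t] := acyclic_leaf acT supp0; rewrite inE => t0 dt.
have [[x xt xq]|[p [tp btp only_p]]] := leaf_bagP t0 dt.
  by exists x, t; split; [apply: subsetP xt | apply: deg_in_lt_bag].
have [|x [i [xS dx]]] := IH _ _ (decomposes_drop_leaf dec tp btp only_p).
  rewrite -ltnS; apply: leq_trans szn; rewrite ltnS [X in _ < X](cardsD1 t) inE t0.
  rewrite ltnS; apply/subset_leq_card/subsetP=> i; rewrite !inE.
  by case: (i == t); rewrite ?eqxx.
by exists x, i; split=> //; move: dx; case: eqP => //; rewrite cards0.
Qed.

Lemma treewidth_min_degree (G : sgraph) (d : nat) :
  0 < #|G| -> min_degree_geq G d -> d <= treewidth G.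
Proof.
move=> /card_gt0P[x0 _] degG.
apply: leq_treewidth => k /tw_leE[T [bag [[_ acT] dec szb]]].
have G0 : [set: G] != set0 by apply/set0Pn; exists x0.
have [x [i [_]]] := decomposes_deg_in acT dec G0; rewrite deg_in_setT => dx.
by rewrite -ltnS (leq_trans _ (szb i)) // (leq_ltn_trans (degG x)).
Qed.

Definition minor_model (H G : sgraph) (B : H -> {set G}) : Prop :=
  [/\ forall h, B h != set0,
      forall h h' x, x \in B h -> x \in B h' -> h = h',
      forall h, connected_on (fun x => x \in B h) &
      forall h h', adj h h' -> exists x y, [/\ x \in B h, y \in B h' & adj x y]].

Lemma decomposes_connected_on (G T : sgraph) (S B : {set G}) (bag : T -> {set G}) :
    decomposes S bag -> B \subset S -> connected_on (fun x => x \in B) ->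
  connected_on (fun i => B :&: bag i != set0).
Proof.
move=> [_ _ edg con] /subsetP BS conB i j.
move=> /set0Pn[x /setIP[xB xi]] /set0Pn[y /setIP[yB yj]].
set e := adj_in _.
have inbag z a b : z \in B -> z \in bag a -> z \in bag b -> connect e a b.
  move=> zB za zb; apply: connect_adj_in_sub (con z a b za zb) => c zc.
  by apply/set0Pn; exists z; rewrite inE zB.
have {yB} xy := conB x y xB yB; move: y xy j yj.
apply: connect_ind => [j|y z IH /and3P[yz yB zB] j zj]; first exact: inbag.
have [l /andP[yl zl]] := edg y z (BS y yB) (BS z zB) yz.
exact: connect_trans (IH l yl) (inbag z l j zB zl zj).
Qed.

Lemma decomposes_minor (H G T : sgraph) (B : H -> {set G}) (bag : T -> {set G}) :
    minor_model B -> decomposes [set: G] bag ->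
  decomposes [set: H] (fun i => [set h | B h :&: bag i != set0]).
Proof.
move=> [B0 _ Bcon Badj] dec; have [_ cov edg _] := dec.
split=> [i|h _|h h' _ _ hh'|h]; first exact: subsetT.
- have /set0Pn[x xh] := B0 h; have [i xi] := cov x (in_setT x).
  by exists i; rewrite inE; apply/set0Pn; exists x; rewrite inE xh.
- have [x [y [xh yh' xy]]] := Badj h h' hh'.
  have [i /andP[xi yi]] := edg x y (in_setT x) (in_setT y) xy; exists i; rewrite !inE.
  by apply/andP; split; apply/set0Pn; [exists x | exists y]; rewrite inE ?xh ?yh'.
- apply: eq_connected_on (decomposes_connected_on dec (subsetT _) (Bcon h)) => i.
  by rewrite inE.
Qed.

Lemma treewidth_minor (H G : sgraph) (B : H -> {set G}) :
  minor_model B -> treewidth H <= treewidth G.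
Proof.
move=> mB; have [B0 Bdisj _ _] := mB.
apply: leq_treewidth => k /tw_leE[T [bag [treeT dec szb]]].
apply/treewidth_leq/tw_leE; exists T, (fun i => [set h | B h :&: bag i != set0]).
split=> // [|i]; first exact: decomposes_minor.
have /fin_all_exists[rep repP] h :
    exists x, x \in B h /\ (B h :&: bag i != set0 -> x \in bag i).
  have [Bi|/set0Pn[x]] := eqVneq (B h :&: bag i) set0.
    by have /set0Pn[x xh] := B0 h; exists x.
  by rewrite inE => /andP[xh xi]; exists x.
apply: leq_trans (szb i); apply: (@leq_card_inj_in _ _ rep) => [h h' _ _ hh'|h].
  by have [rh _] := repP h; have [+ _] := repP h'; rewrite -hh'; apply: Bdisj rh.
by rewrite inE; apply: (repP h).2.
Qed.

(** * Peeling *)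

Section Pendant.

Variables (T : sgraph) (i0 : T).

Definition pendant_adj : rel (option T) := fun u v =>
  match u, v with
  | Some a, Some b => adj a b
  | Some a, None | None, Some a => a == i0
  | None, None => false
  end.

Lemma pendant_adj_sym : symmetric pendant_adj.
Proof. by move=> [a|] [b|] //=; apply: adj_sym. Qed.

Lemma pendant_adj_irr : irreflexive pendant_adj.
Proof. by move=> [a|] //=; apply: adj_irr. Qed.

Definition pendant := SGraph pendant_adj_sym pendant_adj_irr.

Lemma pendant_connected : connected T -> connected pendant.
Proof.
move=> [_ conT]; split; first by apply/card_gt0P; exists None.
have old a b : connect (@adj pendant) (Some a) (Some b).
  by apply: connect_homo (conT a b) => x y xy; apply: connect1.
have new a : connect (@adj pendant) None (Some a).
  by apply: connect_trans (old i0 a); apply: connect1; rewrite /= eqxx.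
have csym : connect_sym (@adj pendant) by apply: sym_connect_sym; apply: adj_sym.
by move=> [a|] [b|] //; rewrite csym.
Qed.

Lemma pendant_acyclic : acyclic T -> acyclic pendant.
Proof.
move=> /acyclicE acT; apply/acyclicE=> cyc.
have dN : deg_in [set: pendant] None <= 1.
  apply/card_le1_eqP=> [[a|] [b|]]; rewrite !inE //=.
  by move=> /eqP -> /eqP ->.
have [c cc cS] := has_cycle_in_del dN cyc; apply: acT.
have c_some : {subset c <= codom (@Some T)}.
  by move=> [a|] /cS; rewrite !inE // => _; apply: codom_f.
exists (preim_seq Some c) => [|x]; last by rewrite inE.
by rewrite -(@is_cycle_map T pendant Some _ Some_inj) // map_preim.
Qed.

Lemma pendant_tree : is_tree T -> is_tree pendant.
Proof.
by case=> conT acT; split; [apply: pendant_connected | apply: pendant_acyclic].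
Qed.

Definition pendant_bag (U : Type) (B : U) (bag : T -> U) (u : pendant) : U :=
  if u is Some i then bag i else B.

Lemma decomposes_pendant (G : sgraph) (S : {set G}) (x : G) (bag : T -> {set G}) :
    x \in S -> decomposes (S :\ x) bag -> [set y in S | adj x y] \subset bag i0 ->
  decomposes S (pendant_bag (x |: [set y in S | adj x y]) bag).
Proof.
move=> xS [bagS cov edg con]; set N := [set y in S | adj x y] => Ni0.
have edgx y : y \in S -> adj x y -> (x \in x |: N) && (y \in x |: N).
  by move=> yS xy; rewrite !inE eqxx yS xy orbT.
split.
- case=> [i|] /=; first exact: subset_trans (bagS i) (subsetDl _ _).
  by apply/subsetP=> y; rewrite !inE => /predU1P[->//|/andP[]].
- move=> v vS; have [->|vx] := eqVneq v x; first by exists None; rewrite /= !inE eqxx.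
  by have [|i vi] := cov v; [rewrite !inE vx | exists (Some i)].
- move=> y z yS zS yz; have [yx|yx] := eqVneq y x.
    by exists None; rewrite yx in yz *; apply: edgx.
  have [zx|zx] := eqVneq z x.
    by exists None; rewrite zx in yz *; rewrite andbC; apply: edgx; rewrite // adj_sym.
  have [| |i yzi] := edg y z _ _ yz; rewrite ?inE ?yx ?zx //.
  by exists (Some i).
- move=> v; rewrite /connected_on; set e := adj_in _.
  have old a b : v \in bag a -> v \in bag b -> connect e (Some a) (Some b).
    by move=> va vb; apply: connect_homo (con v a b va vb) => c d cd; apply: connect1.
  have new a : v \in bag a -> v \in x |: N -> connect e None (Some a).
    move=> va /[dup] vN; rewrite in_setU1 => /predU1P[vx|/(subsetP Ni0) vi0].
      by have := subsetP (bagS a) v va; rewrite vx !inE eqxx.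
    apply: connect_trans (old i0 a vi0 va); apply: connect1.
    by rewrite /e /adj_in /= eqxx vN.
  move=> [a|] [b|] va vb; [exact: old| |exact: new|exact: connect0].
  by rewrite connect_adj_in_sym; apply: new.
Qed.

End Pendant.

Section Peeling.

Variable F : sgraph.

Lemma peel_ind (P : {set F} -> Prop) :
    (forall (S : {set F}) x, x \in S -> deg_in S x <= 1 -> P (S :\ x) -> P S) ->
  forall S, connect (@peel_step F) setT S -> P S -> P setT.
Proof.
move=> unpeel; apply: connect_ind => // S S' IH /existsP[x /and3P[xS dx /eqP ->]] PS'.
exact/IH/unpeel/PS'.
Qed.

Lemma core_exists : exists F0 : {set F}, is_core F0.
Proof.
case: (@arg_minnP _ [set: F] (connect (@peel_step F) setT) (fun S => #|S|)).
  exact: connect0.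
move=> S TS Smin; exists S; split=> // x xS; rewrite ltnNge; apply/negP=> dx.
have : #|S| <= #|S :\ x|.
  apply/Smin/(connect_trans TS)/connect1/existsP; exists x.
  by rewrite xS dx eqxx.
by rewrite (cardsD1 x) xS ltnn.
Qed.

Lemma core_card (F0 : {set F}) : is_core F0 -> F0 = set0 \/ 2 < #|F0|.
Proof.
move=> [_ degF0]; have [->|/set0Pn[x xF0]] := eqVneq F0 set0; [by left|right].
exact: leq_ltn_trans (degF0 x xF0) (deg_in_lt_card xF0).
Qed.

Lemma empty_core_acyclic : is_core (set0 : {set F}) -> acyclic F.
Proof.
move=> [T0 _]; apply/acyclicE.
apply: (peel_ind (P := fun S : {set F} => ~ has_cycle_in S) _ T0) => [S x _ dx noc cyc|].
  exact/noc/has_cycle_in_del.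
by case=> [[|x c]] // _ /(_ x (mem_head x c)); rewrite inE.
Qed.

Lemma tw_le_on_unpeel (S : {set F}) x k :
  0 < k -> x \in S -> deg_in S x <= 1 -> tw_le_on (S :\ x) k -> tw_le_on S k.
Proof.
move=> k0 xS dx [T [bag [treeT dec szb]]]; have [_ cov _ _] := dec.
have [i0 Ni0] : exists i, [set y in S | adj x y] \subset bag i.
  have [->|/set0Pn[p /[dup] pN]] := eqVneq [set y in S | adj x y] set0.
    by have /card_gt0P[i _] := treeT.1.1; exists i; rewrite sub0set.
  rewrite inE => /andP[pS xp]; have [|i pi] := cov p.
    by rewrite !inE pS eq_sym (adj_neq xp).
  exists i; apply/subsetP=> y yN.
  by move/card_le1_eqP: dx => /(_ p y pN yN) ->.
exists (pendant i0), (pendant_bag (x |: [set y in S | adj x y]) bag); split.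
- exact: pendant_tree.
- exact: decomposes_pendant.
- case=> [i|] //=; rewrite cardsU1; apply: leq_trans (leq_add (leq_b1 _) dx) _.
  by rewrite ltnS.
Qed.

Lemma treewidth_core (F0 : {set F}) : is_core F0 -> treewidth F <= maxn 1 #|F0|.-1.
Proof.
move=> [TF0 _]; set k := maxn _ _; apply/treewidth_leq/tw_leE.
apply: (peel_ind (P := fun S : {set F} => tw_le_on S k) _ TF0) => [S x|].
  by apply: tw_le_on_unpeel; apply: leq_maxl.
by apply: tw_le_on_card; rewrite /k; lia.
Qed.

End Peeling.

(** * Graphs of large girth and degree *)

Section CayleyGraph.

Local Open Scope group_scope.

Variables (gT : finGroupType) (I : finType) (gen : I -> gT).
Hypotheses (genK : forall i, gen i * gen i = 1) (gen_neq1 : forall i, gen i != 1).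

Definition cayley_adj : rel gT := [rel x y | [exists i, y == x * gen i]].

Lemma cayley_adj_sym : symmetric cayley_adj.
Proof.
suff sub x y : cayley_adj x y -> cayley_adj y x by move=> x y; apply/idP/idP; apply: sub.
by case/existsP=> i /eqP ->; apply/existsP; exists i; rewrite -mulgA genK mulg1.
Qed.

Lemma cayley_adj_irr : irreflexive cayley_adj.
Proof.
move=> x; apply/existsP=> -[i]; rewrite -{1}[x]mulg1 (inj_eq (mulgI x)) eq_sym.
by rewrite (negPf (gen_neq1 i)).
Qed.

Definition cayley_graph := SGraph cayley_adj_sym cayley_adj_irr.

Lemma cayley_min_degree : injective gen -> min_degree_geq cayley_graph #|I|.
Proof.
move=> gen_inj x; apply: (@leq_card_inj_in _ _ (fun i => x * gen i)) => [i j _ _|i _].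
  by move/mulgI/gen_inj.
by rewrite inE; apply/existsP; exists i.
Qed.

Definition walk (x : gT) (w : seq I) : seq gT := scanl (fun y i => y * gen i) x w.

Definition reduced (w : seq I) : bool := sorted [rel i j | i != j] w.

Lemma reduced_cons i w : reduced (i :: w) = (ohead w != Some i) && reduced w.
Proof.
case: w => //= j w; rewrite /reduced /= eq_sym.
by congr (_ && _); congr negb; apply/eqP/eqP=> [->|[]].
Qed.

Definition spell (w : seq I) : gT := \prod_(i <- w) gen i.

Lemma last_walk x w : last x (walk x w) = x * spell w.
Proof.
elim: w x => [|i w IH] x /=; first by rewrite /spell big_nil mulg1.
by rewrite IH /spell big_cons mulgA.
Qed.

Lemma path_walk x p : path cayley_adj x p -> exists w, p = walk x w.
Proof.
elim: p x => [|y p IH] x /=; first by exists [::].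
case/andP=> /existsP[i /eqP ->] /IH[w ->]; by exists (i :: w).
Qed.

Lemma uniq_walk_reduced x w : uniq (x :: walk x w) -> reduced w.
Proof.
elim: w x => [|i [|j w] IH] x //; rewrite [walk _ _]/= cons_uniq => /andP[xw uw].
have : reduced (j :: w) by apply: IH uw.
rewrite /reduced /= => ->; rewrite andbT; apply: contraNneq xw => ->.
by rewrite -mulgA genK mulg1 !inE eqxx orbT.
Qed.

Lemma cayley_girth g :
    (forall w, reduced w -> 0 < size w <= g -> spell w != 1) ->
  girth_gt cayley_graph g.
Proof.
move=> free [|x p] /and3P[// p2 up /path_walk[w pE]].
have szw : size w = (size p).+1 by rewrite -(size_rcons p x) pE size_scanl.
have w1 : spell w = 1.
  by apply: (mulgI x); rewrite -last_walk -pE last_rcons mulg1.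
rewrite ltnNge; apply/negP=> pg.
suff /free : reduced w by rewrite szw pg w1 eqxx => /(_ isT).
case: w pE szw {w1} => [|i [|j w]] // pE _.
have rw : reduced (j :: w).
  apply: (@uniq_walk_reduced (x * gen i)).
  by rewrite -[_ :: _]/(walk x [:: i, j & w]) -pE rcons_uniq.
rewrite /reduced /=; apply/andP; split=> //; apply/eqP=> ij.
case: p pE p2 up {pg} => [|y [|z p]] // [_ zE _] _.
by rewrite zE ij -mulgA genK mulg1 /= !inE eqxx orbT.
Qed.

End CayleyGraph.

Section WordFlips.

Variables (I : finType) (r : nat).

(* Multiplication by the i-th generator of the free product of #|I| copies of Z/2,
   truncated to the ball of radius r; non-reduced words are junk and left fixed. *)
Definition flip_seq (i : I) (w : seq I) : seq I :=
  if ~~ reduced w then w else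
  if ohead w == Some i then behead w else
  if size w < r then i :: w else w.

Lemma size_flip_seq i (w : r.-bseq I) : size (flip_seq i w) <= r.
Proof.
rewrite /flip_seq; case: ifP => _; first exact: size_bseq.
case: ifP => _; last by case: ifP => // _; apply: size_bseq.
by rewrite size_behead (leq_trans (leq_pred _)) ?size_bseq.
Qed.

Definition flip i (w : r.-bseq I) : r.-bseq I := Bseq (size_flip_seq i w).

Lemma flip_seq_cons i w : reduced (i :: w) -> size w < r -> flip_seq i w = i :: w.
Proof.
by rewrite reduced_cons /flip_seq => /andP[/negPf -> ->] ->.
Qed.

Lemma flipK i : involutive (flip i).
Proof.
move=> w; apply: val_inj => /=; have := size_bseq w; move: (bseqval w) => {}w.
rewrite {2}/flip_seq; case: ifPn => [nr _|]; first by rewrite /flip_seq nr.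
rewrite negbK => rw szw; case: eqP => [hw|/eqP hw].
  by case: w hw rw szw => // j w [->]; apply: flip_seq_cons.
case: ifP => szw'; last by rewrite /flip_seq rw (negPf hw) szw'.
by rewrite /flip_seq reduced_cons hw rw /= eqxx.
Qed.

Definition flip_perm i : {perm r.-bseq I} := perm (inv_inj (flipK i)).

Lemma flip_permK i : (flip_perm i * flip_perm i = 1)%g.
Proof. by apply/perm.permP=> w; rewrite permM !permE flipK. Qed.

Let nil_word : r.-bseq I := @Bseq r _ [::] isT.

Lemma spell_flip_perm (w : seq I) :
  reduced w -> size w <= r -> spell flip_perm (rev w) nil_word = w :> seq _.
Proof.
rewrite /spell; elim: w => [|i w IH] rw szw; first by rewrite big_nil perm1.
rewrite rev_cons -cats1 big_cat big_seq1 permM permE /= IH; last exact: ltnW.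
  exact: flip_seq_cons.
by move: rw; rewrite reduced_cons => /andP[].
Qed.

Lemma spell_flip_perm_neq1 (w : seq I) :
  reduced w -> 0 < size w <= r -> spell flip_perm w != 1%g.
Proof.
move=> rw /andP[w0 wr]; have rv : reduced (rev w).
  by rewrite /reduced rev_sorted; apply: sub_sorted rw => i j; rewrite /= eq_sym.
apply: contraTneq w0 => w1; rewrite -size_rev.
by rewrite -(spell_flip_perm rv) ?size_rev // revK w1 perm1.
Qed.

Lemma flip_perm_inj : 0 < r -> injective flip_perm.
Proof.
move=> r0 i j ij; have flip1 k : flip_perm k nil_word = [:: k] :> seq _.
  by rewrite permE /= flip_seq_cons.
by have := flip1 j; rewrite -ij flip1 => -[].
Qed.

End WordFlips.

Section InducedSubgraph.

Variables (G : sgraph) (S : {set G}).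

Definition induced_adj : rel {x | x \in S} := [rel x y | adj (val x) (val y)].

Lemma induced_adj_sym : symmetric induced_adj.
Proof. by move=> x y; apply: adj_sym. Qed.

Lemma induced_adj_irr : irreflexive induced_adj.
Proof. by move=> x; apply: adj_irr. Qed.

Definition induced := SGraph induced_adj_sym induced_adj_irr.

Lemma induced_girth g : girth_gt G g -> girth_gt induced g.
Proof.
move=> gG c cyc; rewrite -(size_map (val : induced -> G)); apply: gG.
by rewrite (is_cycle_map _ (f := val : induced -> G)) //; apply: val_inj.
Qed.

Lemma induced_degree (x : induced) : #|adj x| = deg_in S (val x).
Proof.
rewrite -(card_imset _ val_inj); apply: eq_card => y; rewrite inE.
apply/imsetP/andP=> [[z xz ->]|[yS xy]]; first by split; [apply: valP|].
by exists (exist _ y yS).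
Qed.

End InducedSubgraph.

Section Component.

Variables (G : sgraph) (x0 : G).

Definition component := induced [set x | connect adj x0 x].

Lemma component_connected : connected component.
Proof.
have r0 : x0 \in [set x | connect adj x0 x] by rewrite inE connect0.
pose root : component := exist _ x0 r0.
have csym : connect_sym (@adj component) by apply: sym_connect_sym; apply: adj_sym.
have from_root y : connect adj x0 y ->
    exists yC, connect adj root (exist _ y yC : component).
  move: y; apply: connect_ind => [|y z [yC ry] yz]; first by exists r0; apply: connect0.
  have zC : z \in [set x | connect adj x0 x].
    by have := yC; rewrite !inE => /connect_trans; apply; apply: connect1.
  by exists zC; apply: connect_trans ry (connect1 _).
have {}from_root (y : component) : connect adj root y.
  case: y => y yC; have /from_root[yC'] : connect adj x0 y by rewrite inE in yC.
  by rewrite (bool_irrelevance yC yC').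
split; first by apply/card_gt0P; exists root.
by move=> x y; apply: connect_trans (from_root y); rewrite csym.
Qed.

Lemma component_min_degree d : min_degree_geq G d -> min_degree_geq component d.
Proof.
move=> dG x; rewrite induced_degree; apply: leq_trans (dG (val x)) _.
apply/subset_leq_card/subsetP=> y xy; rewrite !inE; apply/andP; split=> //.
by have := valP x; rewrite inE => /connect_trans; apply; apply: connect1.
Qed.

End Component.

Lemma large_girth_graph (d g : nat) :
  exists A : sgraph, [/\ connected A, girth_gt A g & min_degree_geq A d].
Proof.
have gen_neq1 i : @flip_perm 'I_d g.+1 i != 1%g.
  have := @spell_flip_perm_neq1 'I_d g.+1 [:: i] isT isT.
  by rewrite /spell big_seq1.
exists (component (1%g : cayley_graph (@flip_permK 'I_d g.+1) gen_neq1)); split.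
- exact: component_connected.
- apply: induced_girth => c cyc; apply: ltnW.
  by apply: cayley_girth cyc; apply: spell_flip_perm_neq1.
- apply: component_min_degree; rewrite -[X in min_degree_geq _ X]card_ord.
  by apply: cayley_min_degree; apply: flip_perm_inj.
Qed.

(** * Embeddings and rooted products *)

Definition embeds_on (F G : sgraph) (S : {set F}) (f : F -> G) : Prop :=
  {in S &, injective f} /\ {in S &, {homo f : x y / adj x y}}.

Lemma containsE (F G : sgraph) :
  contains G F <-> exists f : F -> G, embeds_on setT f.
Proof.
split=> -[f [f_inj f_adj]]; exists f.
  by split=> [x y _ _|x y _ _]; [apply: f_inj | apply: f_adj].
by split=> x y; [apply: f_inj | apply: f_adj].
Qed.

Lemma embeds_on_extend (F G : sgraph) (S : {set F}) (x : F) (v : G) (f : F -> G) :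
    embeds_on (S :\ x) f -> {in S :\ x, forall y, f y != v} ->
    {in S, forall y, adj x y -> adj v (f y)} ->
  embeds_on S [eta f with x |-> v].
Proof.
move=> [f_inj f_adj] f_v vf.
have del y : y \in S -> y != x -> y \in S :\ x by move=> yS yx; rewrite !inE yx.
split=> y z yS zS /=; have [->|yx] := eqVneq y x; have [->|zx] := eqVneq z x => //.
- by move/esym/eqP; rewrite (negPf (f_v _ _)) ?del.
- by move/eqP; rewrite (negPf (f_v _ _)) ?del.
- by apply: f_inj; apply: del.
- by rewrite adj_irr.
- exact: vf.
- by rewrite adj_sym (adj_sym (f y)); apply: vf.
- by apply: f_adj; apply: del.
Qed.

Lemma neighbour_outside (G : sgraph) (U : {set G}) (d : nat) (x : G) :
  min_degree_geq G d -> #|U| < d -> exists2 y, adj x y & y \notin U.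
Proof.
move=> dG Ud; have : ~~ (adj x \subset U).
  by apply: contraL Ud => /subset_leq_card; rewrite -leqNgt; apply: leq_trans (dG x).
by case/subsetPn=> y; exists y.
Qed.

Lemma embeds_on_unpeel (F G : sgraph) (S : {set F}) (x : F) (f : F -> G) :
    min_degree_geq G #|F| -> x \in S -> deg_in S x <= 1 -> embeds_on (S :\ x) f ->
  exists g : F -> G, embeds_on S g.
Proof.
move=> dG xS dx fS; pose used := f @: (S :\ x).
have usedF : #|used| < #|F|.
  apply: leq_ltn_trans (leq_imset_card _ _) (leq_trans _ (max_card S)).
  by rewrite [X in _ < X](cardsD1 x) xS.
have [v nbv vn] : exists2 v, {in S, forall y, adj x y -> adj v (f y)} & v \notin used.
  have [N0|/set0Pn[p /[dup] pN]] := eqVneq [set y in S | adj x y] set0.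
    have [v _ vn] := neighbour_outside (f x) dG usedF; exists v => // y yS xy.
    by have := in_set0 y; rewrite -N0 inE yS xy.
  have [v pv vn] := neighbour_outside (f p) dG usedF; exists v => // y yS xy.
  by rewrite adj_sym; move/card_le1_eqP: dx => /(_ p y pN) ->; rewrite ?inE ?yS.
exists [eta f with x |-> v]; apply: embeds_on_extend => // y ySx.
by apply: contraNneq vn => <-; apply: imset_f.
Qed.

Lemma embeds_on_contains (F G : sgraph) (S : {set F}) (f : F -> G) :
    min_degree_geq G #|F| -> connect (@peel_step F) setT S -> embeds_on S f ->
  contains G F.
Proof.
move=> dG TS fS; apply/containsE.
apply: (peel_ind (P := fun S => exists g : F -> G, embeds_on S g) _ TS); last by exists f.
by move=> U x xU dx [g]; apply: embeds_on_unpeel.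
Qed.

Definition complete_adj (n : nat) : rel 'I_n := [rel x y | x != y].

Lemma complete_adj_sym n : symmetric (@complete_adj n).
Proof. by move=> x y; rewrite /complete_adj /= eq_sym. Qed.

Lemma complete_adj_irr n : irreflexive (@complete_adj n).
Proof. by move=> x; rewrite /complete_adj /= eqxx. Qed.

Definition complete_graph n := SGraph (@complete_adj_sym n) (@complete_adj_irr n).

Lemma complete_graph_treewidth n : n <= treewidth (complete_graph n.+1).
Proof.
apply: treewidth_min_degree => [|x]; first by rewrite card_ord.
have := cardC1 x; rewrite card_ord /= => cx; apply/eq_leq/esym; apply: etrans cx.
by apply: eq_card => y; rewrite !inE /= eq_sym.
Qed.

Lemma complete_graph_connected n : connected (complete_graph n.+1).
Proof.
split; first by rewrite card_ord.
by move=> x y; have [->|xy] := eqVneq x y; [apply: connect0 | apply: connect1].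
Qed.

Lemma embeds_on_complete (F : sgraph) (S : {set F}) (n : nat) :
  (exists f : F -> complete_graph n.+1, embeds_on S f) <-> #|S| <= n.+1.
Proof.
split=> [[f [f_inj _]]|Sn]; first by have := leq_card_in _ _ f_inj; rewrite card_ord.
have [->|/set0Pn[x0 x0S]] := eqVneq S set0.
  by exists (fun _ => ord0); split=> x y; rewrite inE.
pose f x := widen_ord Sn (enum_rank_in x0S x).
have f_inj : {in S &, injective f}.
  by move=> x y xS yS /(congr1 val)/= /val_inj/enum_rank_in_inj; apply.
exists f; split=> // x y xS yS xy; rewrite /= /complete_adj /=.
by apply: contra_neq (adj_neq xy); apply: f_inj.
Qed.

Lemma complete_graph_contains (F : sgraph) n :
  #|F| <= n.+1 -> contains (complete_graph n.+1) F.
Proof. by rewrite -cardsT => /embeds_on_complete/containsE. Qed.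

Section RootedProduct.

Variables (K A : sgraph) (r : A).

Definition rooted_adj : rel (K * A) := fun u v =>
  (u.1 == v.1) && adj u.2 v.2 || [&& adj u.1 v.1, u.2 == r & v.2 == r].

Lemma rooted_adj_sym : symmetric rooted_adj.
Proof.
move=> u v; rewrite /rooted_adj eq_sym adj_sym [adj u.1 _]adj_sym.
by rewrite [(_ == r) && _]andbC.
Qed.

Lemma rooted_adj_irr : irreflexive rooted_adj.
Proof. by move=> u; rewrite /rooted_adj !adj_irr andbF. Qed.

Definition rooted_product := SGraph rooted_adj_sym rooted_adj_irr.

Lemma rooted_product_min_degree d : min_degree_geq A d -> min_degree_geq rooted_product d.
Proof.
move=> dA [i a]; apply: leq_trans (dA a) _.
apply: (@leq_card_inj_in _ _ (fun b => (i, b))) => [b c _ _ []//|b ab].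
by apply/orP; left; rewrite eqxx.
Qed.

Lemma rooted_product_connected : connected K -> connected A -> connected rooted_product.
Proof.
move=> [/card_gt0P[i0 _] conK] [_ conA].
have copy i a b : connect (@adj rooted_product) (i, a) (i, b).
  apply: (connect_homo (f := fun c => (i, c) : rooted_product)) (conA a b) => c e ce.
  by apply: connect1; rewrite /= /rooted_adj /= eqxx ce.
have roots i j : connect (@adj rooted_product) (i, r) (j, r).
  apply: (connect_homo (f := fun k => (k, r) : rooted_product)) (conK i j) => k l kl.
  by apply: connect1; rewrite /= /rooted_adj /= kl !eqxx orbT.
split; first by apply/card_gt0P; exists (i0, r).
move=> [i a] [j b].
exact: connect_trans (copy i a r) (connect_trans (roots i j) (copy j r b)).
Qed.

Lemma adj_off_root (u v : rooted_product) :
  u.2 != r -> adj u v -> u.1 = v.1 /\ adj u.2 v.2.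
Proof.
by move=> /negPf ur; rewrite /= /rooted_adj ur andbF orbF => /andP[/eqP].
Qed.

(* The part of the image in one copy of A would have minimum degree 2 away from the
   root, so it would contain a cycle. *)
Lemma embeds_on_roots (F : sgraph) (S : {set F}) (f : F -> rooted_product) :
    girth_gt A #|S| -> embeds_on S f -> {in S, forall x, 1 < deg_in S x} ->
  {in S, forall x, (f x).2 = r}.
Proof.
move=> gA [f_inj f_adj] Sdeg x xS; apply/eqP/negPn/negP=> xr.
pose i := (f x).1; pose S' := [set (f y).2 | y in [set y in S | (f y).1 == i]].
suff : has_cycle_in S'.
  apply: (girth_no_cycle_in gA); apply: leq_trans (leq_imset_card _ _) _.
  by rewrite setIdE subset_leq_card ?subsetIl.
apply: (@min_degree_has_cycle _ _ r (f x).2) => // [|_ /imsetP[y + ->] yr].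
  by apply/imsetP; exists x; rewrite // inE xS eqxx.
rewrite inE => /andP[yS /eqP yi]; apply: leq_trans (Sdeg y yS) _.
have nb z : z \in S -> adj y z -> (f z).1 = i /\ adj (f y).2 (f z).2.
  by move=> zS yz; have [<- ->] := adj_off_root yr (f_adj y z yS zS yz).
apply: (@leq_card_inj_in _ _ (fun z => (f z).2)) => [z t|z]; rewrite !inE.
  move=> /andP[zS yz] /andP[tS yt] zt; apply: f_inj => //.
  have [z1 _] := nb z zS yz; have [t1 _] := nb t tS yt.
  by apply: injective_projections => //; rewrite z1 t1.
move=> /andP[zS yz]; have [z1 ->] := nb z zS yz; rewrite andbT.
by apply/imsetP; exists z; rewrite // inE zS z1 eqxx.
Qed.

Lemma rooted_product_contains (F : sgraph) (F0 : {set F}) :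
    min_degree_geq A #|F| -> girth_gt A #|F| -> is_core F0 ->
  contains rooted_product F <-> exists f : F -> K, embeds_on F0 f.
Proof.
move=> dA gA [peelF0 degF0].
split=> [/containsE[f [f_inj f_adj]]|[f [f_inj f_adj]]].
  have gA0 : girth_gt A #|F0| by move=> c /gA; apply: leq_ltn_trans (max_card _).
  have fF0 : embeds_on F0 f.
    by split=> x y _ _; [apply: f_inj; rewrite inE | apply: f_adj; rewrite inE].
  have froot := embeds_on_roots gA0 fF0 degF0.
  exists (fun x => (f x).1); split=> x y xF yF.
    move=> xy; apply: f_inj; rewrite ?inE //.
    by apply: injective_projections; rewrite // !froot.
  move/(f_adj x y (in_setT x) (in_setT y)).
  by rewrite /= /rooted_adj !froot // adj_irr andbF => /andP[].
apply: (@embeds_on_contains F rooted_product F0 (fun x => (f x, r))) => //.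
  exact: rooted_product_min_degree.
split=> x y xF yF; first by case=> /f_inj; apply.
by move/(f_adj x y xF yF) => fxy; rewrite /= /rooted_adj /= fxy !eqxx orbT.
Qed.

End RootedProduct.

Arguments rooted_product K {A} r.

(** * Back-and-forth systems *)

Definition partial_iso (G H : sgraph) (V : seq nat) (a : nat -> G) (b : nat -> H) : Prop :=
  {in V &, forall x y, (a x == a y) = (b x == b y) /\ adj (a x) (a y) = adj (b x) (b y)}.

Definition extendable (S T : Type) (V : seq nat)
    (R : (nat -> S) -> (nat -> T) -> Prop) : Prop :=
  forall a b x v, x \in V -> R a b ->
    exists w, R [eta a with x |-> v] [eta b with x |-> w].

Definition back_and_forth (G H : sgraph) (V : seq nat)
    (R : (nat -> G) -> (nat -> H) -> Prop) : Prop :=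
  [/\ forall a b, R a b -> partial_iso V a b,
      extendable V R & extendable V (fun b a => R a b)].

Lemma back_and_forth_sat (G H : sgraph) (V : seq nat) R f (a : nat -> G) (b : nat -> H) :
  back_and_forth V R -> {subset all_vars f <= V} -> R a b -> sat a f <-> sat b f.
Proof.
move=> [iso forth back].
elim: f a b => [x y|x y|f IH|f IHf g IHg|f IHf g IHg|x f IH|x f IH] a b fV Rab /=.
1,2: have [||eqE adjE] := iso a b Rab x y; try by apply: fV; rewrite !inE eqxx ?orbT.
- by split=> /eqP; [rewrite eqE | rewrite -eqE] => /eqP.
- by rewrite adjE.
- by rewrite (IH _ _ fV Rab).
1,2: have [fV1 fV2] : {subset all_vars f <= V} /\ {subset all_vars g <= V}
  by split=> z zf; apply: fV; rewrite mem_cat zf ?orbT.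
1,2: by rewrite (IHf _ _ fV1 Rab) (IHg _ _ fV2 Rab).
1,2: have xV : x \in V by apply: fV; rewrite inE eqxx.
1,2: have {}fV : {subset all_vars f <= V} by move=> z zf; apply: fV; rewrite inE zf orbT.
- split=> [[v sv]|[w sw]].
    by have [w Rw] := forth a b x v xV Rab; exists w; apply/(IH _ _ fV Rw).
  by have [v Rv] := back b a x w xV Rab; exists v; apply/(IH _ _ fV Rv).
- split=> [sa w|sb v].
    by have [v Rv] := back b a x w xV Rab; apply/(IH _ _ fV Rv)/sa.
  by have [w Rw] := forth a b x v xV Rab; apply/(IH _ _ fV Rw)/sb.
Qed.

Lemma back_and_forth_models (G H : sgraph) (f : form) R :
    back_and_forth (all_vars f) R -> (forall b : nat -> H, exists a : nat -> G, R a b) ->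
  models G f -> models H f.
Proof.
move=> bfR exR fG b; have [a Rab] := exR b.
by apply/(back_and_forth_sat bfR _ Rab).
Qed.

Lemma one_variable_models (f : form) (G H : sgraph) :
  0 < #|G| -> var_width f <= 1 -> models G f -> models H f.
Proof.
move=> /card_gt0P[g _] f1.
apply: (@back_and_forth_models _ _ _ (fun _ _ => True)) => [|b].
  split=> [a b _ x y|a b x v _ _|b a x w _ _]; [|by exists (b x)|by exists (a x)].
  rewrite -mem_undup -(mem_undup (all_vars f) y); move: f1; rewrite /var_width.
  case: (undup _) => [|z [|]] //; rewrite !inE => _ /eqP -> /eqP ->.
  by rewrite !eqxx !adj_irr.
by exists (fun _ => g).
Qed.

Definition same_equalities (S T : eqType) (V : seq nat)
    (a : nat -> S) (b : nat -> T) : Prop :=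
  {in V &, forall x y, (a x == a y) = (b x == b y)}.

Lemma same_equalities_extendable (S : eqType) (T : finType) (V : seq nat) :
  size (undup V) <= #|T| -> extendable V (@same_equalities S T V).
Proof.
move=> VT a b x v xV ab.
suff [w wP] : exists w, {in V, forall y, y != x -> (a y == v) = (b y == w)}.
  exists w => y z yV zV /=; have [_|yx] := eqVneq y x; have [_|zx] := eqVneq z x.
  - by rewrite !eqxx.
  - by rewrite eq_sym wP // eq_sym.
  - exact: wP.
  - exact: ab.
have [[y yV /andP[yx /eqP ay]]|new] :=
    pselect (exists2 y, y \in V & (y != x) && (a y == v)).
  by exists (b y) => z zV zx; rewrite -ab // ay.
pose used := [seq b y | y <- rem x (undup V)].
have usedT : #|used| < #|T|.
  apply: leq_ltn_trans (card_size _) _; apply: leq_trans VT.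
  rewrite size_map size_rem ?mem_undup // ltn_predL.
  by move: xV; rewrite -mem_undup; case: (undup V).
have /card_gt0P[w] : 0 < #|[predC used]| by rewrite -(ltn_add2l #|used|) addn0 cardC.
rewrite inE => /= wn; exists w => y yV yx; apply: etrans (_ : false = _).
  by apply/negP=> ay; apply: new; exists y; rewrite ?yx.
apply/esym; apply: contraNF wn => /eqP <-; apply: map_f.
by rewrite mem_rem_uniq ?undup_uniq // !inE yx mem_undup.
Qed.

Lemma complete_graph_back_and_forth (V : seq nat) n m :
    size (undup V) <= n -> size (undup V) <= m ->
  @back_and_forth (complete_graph n) (complete_graph m) V (same_equalities V).
Proof.
move=> Vn Vm; split=> [a b ab x y xV yV|a b x v xV ab|b a x w xV ab].
- by rewrite /= /complete_adj /= (ab x y xV yV).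
- by apply: same_equalities_extendable; rewrite ?card_ord.
- have [|y z yV zV|v bav] := @same_equalities_extendable 'I_m 'I_n V _ b a x w xV.
  + by rewrite card_ord.
  + by rewrite ab.
  + by exists v => y z yV zV; rewrite bav.
Qed.

Definition lift_to_product (S T A : Type) (V : seq nat)
    (R : (nat -> S) -> (nat -> T) -> Prop) (a : nat -> S * A) (b : nat -> T * A) : Prop :=
  R (fst \o a) (fst \o b) /\ {in V, forall x, (a x).2 = (b x).2}.

Lemma fst_comp_update (S T : Type) (a : nat -> S * T) x v :
  fst \o [eta a with x |-> v] = [eta fst \o a with x |-> v.1].
Proof. by apply/funext=> y /=; case: eqP. Qed.

Lemma lift_to_product_extendable (S T A : Type) (V : seq nat)
    (R : (nat -> S) -> (nat -> T) -> Prop) :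
  extendable V R -> extendable V (@lift_to_product S T A V R).
Proof.
move=> extR a b x v xV [Rab ab]; have [w Rw] := extR _ _ x v.1 xV Rab.
exists (w, v.2); split=> [|y yV /=]; first by rewrite !fst_comp_update.
by case: eqP => // _; apply: ab.
Qed.

Lemma rooted_product_back_and_forth (K L A : sgraph) (r : A) (V : seq nat) R :
    back_and_forth V R ->
  @back_and_forth (rooted_product K r) (rooted_product L r) V (lift_to_product V R).
Proof.
move=> [iso forth back]; split=> [a b [Rab ab] x y xV yV|a b x v xV|b a x w xV [Rab ab]].
- have [/= eq1 adj1] := iso _ _ Rab x y xV yV.
  by rewrite -!pair_eqE /= /rooted_adj !ab // eq1 adj1.
- exact: lift_to_product_extendable.
- have [|v [Rv vw]] := lift_to_product_extendable back w xV (a := b) (b := a).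
    by split=> // y yV; rewrite ab.
  by exists v; split=> // y yV; rewrite vw.
Qed.

Lemma rooted_complete_models (f : form) (A : sgraph) (r : A) n : var_width f <= n ->
  models (rooted_product (complete_graph n.+1) r) f ->
  models (rooted_product (complete_graph n) r) f.
Proof.
move=> fn; apply: back_and_forth_models.
  apply/rooted_product_back_and_forth/complete_graph_back_and_forth => //.
  exact: leqW.
by move=> b; exists (fun x => (widen_ord (leqnSn n) (b x).1, (b x).2)).
Qed.

Lemma Wtw_ge_core (F : sgraph) (F0 : {set F}) : is_core F0 -> Wtw_ge F #|F0|.
Proof.
move=> coreF0 Phi [_ [k defPhi]]; rewrite leqNgt; apply/negP.
have [->|] := core_card coreF0; first by rewrite cards0.
case szF0 : #|F0| => [|[|n]] // _ widthPhi.
have [A [conA gA dA]] := large_girth_graph (maxn k #|F|) #|F|.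
have /card_gt0P[r _] := conA.1; pose G m := rooted_product (complete_graph m.+1) r.
have conG m : connected (G m).
  exact/rooted_product_connected/conA/complete_graph_connected.
have twG m : k <= treewidth (G m).
  apply: treewidth_min_degree; first by have [] := conG m.
  by apply: rooted_product_min_degree => a; apply: leq_trans (dA a); apply: leq_maxl.
have containsG m : contains (G m) F <-> #|F0| <= m.+1.
  rewrite -embeds_on_complete; apply: rooted_product_contains => // a.
  by apply: leq_trans (dA a); apply: leq_maxr.
have modelG : models (G n.+1) Phi.
  by apply/(defPhi _ (conG _) (twG _))/containsG; rewrite szF0.
suff /containsG : contains (G n) F by rewrite szF0 ltnn.
by apply/(defPhi _ (conG _) (twG _)); apply: rooted_complete_models modelG.
Qed.

(** * Glued megastars *)

Section GluedMegastars.

Variables (C : finType) (m t : nat) (tau : C * 'I_m -> C * 'I_m).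
Hypothesis tauK : involutive tau.

Definition glued_adj : rel (C * megastar m t) := fun u v =>
  (u.1 == v.1) && adj u.2 v.2 ||
  match u.2, v.2 with
  | Some (i, j), Some (i', j') =>
      [&& j.+1 == t, j'.+1 == t, tau (u.1, i) == (v.1, i') & (u.1, i) != (v.1, i')]
  | _, _ => false
  end.

Lemma glued_adj_sym : symmetric glued_adj.
Proof.
move=> [c p] [c' p']; rewrite /glued_adj [adj _ _]adj_sym /= eq_sym; congr (_ || _).
case: p p' => [[i j]|] [[i' j']|] //=.
rewrite andbCA [(c, i) == _]eq_sym; congr [&& _, _, _ & _].
by apply/eqP/eqP=> <-; rewrite tauK.
Qed.

Lemma glued_adj_irr : irreflexive glued_adj.
Proof.
by move=> [c [[i j]|]]; rewrite /glued_adj adj_irr andbF //= eqxx !andbF.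
Qed.

(* A copy of M_{m,t} for each c : C, where the ends of the arms (c, i) and
   tau (c, i) are joined by an edge: a subdivision of the multigraph with
   darts C * 'I_m. *)
Definition glued_megastars := SGraph glued_adj_sym glued_adj_irr.

Definition depth (p : megastar m t) : nat := if p is Some (_, j) then j.+1 else 0.

Lemma depth_adj (p q : megastar m t) : adj p q -> depth q <= (depth p).+1.
Proof. by case: p q => [[i j]|] [[i' j']|] //=; lia. Qed.

Lemma glued_adj_inner (u v : C * megastar m t) :
  depth u.2 < t -> glued_adj u v = (u.1 == v.1) && adj u.2 v.2.
Proof.
case: u v => [c [[i j]|]] [c' [[i' j']|]] //= jt; rewrite /glued_adj ?orbF //=.
by rewrite (ltn_eqF jt) orbF.
Qed.

Lemma glued_path_inner (u : C * megastar m t) p :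
  path glued_adj u p -> depth u.2 + size p < t ->
  (last u p).1 = u.1 /\ depth (last u p).2 < t.
Proof.
elim: p u => [|v p IH] u /=; first by rewrite addn0.
move=> /andP[uv vp] upt; have ut := leq_ltn_trans (leq_addr _ _) upt.
move: uv; rewrite glued_adj_inner // => /andP[/eqP -> uv].
by apply: IH vp _; apply: leq_ltn_trans upt; rewrite addnS -addSn leq_add2r depth_adj.
Qed.

Definition arm_point (p : (C * 'I_m) * 'I_t) : glued_megastars :=
  (p.1.1, Some (p.1.2, p.2)).

Lemma adj_arm_point p q : adj (arm_point p) (arm_point q) =
  (p.1 == q.1) && ((p.2.+1 == q.2) || (q.2.+1 == p.2)) ||
  [&& p.2.+1 == t, q.2.+1 == t, tau p.1 == q.1 & p.1 != q.1].
Proof.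
by case: p q => [[c i] j] [[c' i'] j']; rewrite /= /glued_adj /= xpair_eqE andbA.
Qed.

(* The arms D and tau D, joined end to end, form a path numbered from the centre of D. *)
Definition edge_position (D : C * 'I_m) (p : (C * 'I_m) * 'I_t) : nat :=
  if p.1 == D then p.2 : nat else t.*2.-1 - p.2.

Definition on_edge (D : C * 'I_m) : pred ((C * 'I_m) * 'I_t) :=
  [pred p | (p.1 == D) || (p.1 == tau D)].

Lemma edge_position_lt D p : edge_position D p < t.*2.
Proof. by rewrite /edge_position; have := ltn_ord p.2; case: ifP => _; lia. Qed.

Lemma edge_position_inj D : {in on_edge D &, injective (edge_position D)}.
Proof.
move=> [d i] [e j]; rewrite !inE /edge_position /=.
have it := ltn_ord i; have jt := ltn_ord j.
have [-> _|_ /= /eqP ->] := eqVneq d D; have [-> _|_ /= /eqP ->] := eqVneq e D => pos.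
- by congr (_, _); apply: val_inj.
- lia.
- lia.
- by congr (_, _); apply: val_inj => /=; lia.
Qed.

Lemma edge_position_adj D : {in on_edge D &, forall p q,
  adj (arm_point p) (arm_point q) ->
  ((edge_position D p).+1 == edge_position D q) ||
  ((edge_position D q).+1 == edge_position D p)}.
Proof.
move=> [d i] [e j]; rewrite !inE adj_arm_point /edge_position /= => dD eD.
have it := ltn_ord i; have jt := ltn_ord j.
case/orP=> [/andP[/eqP -> ij]|/and4P[i_end j_end /eqP de ne]].
  by case: ifP => _; lia.
have [dD'|dD'] := eqVneq d D; have [eD'|eD'] := eqVneq e D.
- by rewrite dD' eD' eqxx in ne.
- lia.
- lia.
- by move: eD'; rewrite -de; case: eqVneq dD dD' => //= _ /eqP ->; rewrite tauK eqxx.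
Qed.

Lemma on_edge_adj D p q : adj (arm_point p) (arm_point q) -> on_edge D p -> on_edge D q.
Proof.
rewrite adj_arm_point /on_edge /= => /orP[/andP[/eqP -> //]|/and4P[_ _ /eqP <- _]].
by case/orP=> /eqP ->; rewrite ?tauK eqxx ?orbT.
Qed.

Section SmallSubgraph.

Variables (F : sgraph) (f : F -> glued_megastars).
Hypotheses (conF : connected F) (f_inj : injective f) (f_adj : {homo f : x y / adj x y}).

(* F is too small to leave the copy of the megastar around a centre it contains. *)
Lemma megastar_contains_at_centre x0 :
  #|F| <= t -> (f x0).2 = None -> contains (megastar m t) F.
Proof.
move=> Ft x0c.
have near y : (f y).1 = (f x0).1 /\ depth (f y).2 < t.
  have /connectP[p pp ->] := conF.2 x0 y; case/shortenP: pp => q pq uq _.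
  rewrite -last_map; apply: glued_path_inner; first exact: homo_path pq.
  rewrite x0c add0n size_map; apply: leq_trans Ft.
  by have := max_card (mem (x0 :: q)); rewrite (card_uniqP uq).
exists (fun y => (f y).2); split=> [y z yz|y z /f_adj].
  apply: f_inj; apply: injective_projections => //.
  by rewrite (near y).1 (near z).1.
by rewrite [adj _ _]glued_adj_inner; [case/andP | exact: (near y).2].
Qed.

Lemma megastar_contains_off_centres :
  (forall x, (f x).2 != None) -> contains (megastar m t.*2) F.
Proof.
move=> nocentre; have /fin_all_exists[g fE] x : exists p, f x = arm_point p.
  have := nocentre x; case fx: (f x) => [c [[i j]|]] // _.
  by exists ((c, i), j).
have /card_gt0P[x0 _] := conF.1; pose D := (g x0).1.
have g_adj x y : adj x y -> adj (arm_point (g x)) (arm_point (g y)).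
  by rewrite -!fE; apply: f_adj.
have onD y : g y \in on_edge D.
  move: y (conF.2 x0 y); apply: connect_ind => [|y z yD /g_adj yz].
    by rewrite inE /= eqxx.
  exact: on_edge_adj yz yD.
exists (fun y => Some (D.2, Ordinal (edge_position_lt D (g y)))).
split=> [y z [/edge_position_inj yz]|y z /g_adj yz]; last first.
  by rewrite /= eqxx edge_position_adj.
by apply: f_inj; rewrite !fE yz.
Qed.

Lemma glued_megastars_contains : #|F| <= t -> exists b, contains (megastar m b) F.
Proof.
move=> Ft; have [[x0 x0c]|nocentre] := pselect (exists x, (f x).2 = None).
  by exists t; apply: megastar_contains_at_centre x0c.
exists t.*2; apply: megastar_contains_off_centres => x; apply/eqP=> xc.
by apply: nocentre; exists x.
Qed.

End SmallSubgraph.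

End GluedMegastars.

Arguments glued_megastars {C m} t {tau} tauK.

Section Wall.

Variables (n s : nat).

Let arm1 : 'I_3 := @Ordinal 3 1 isT.
Let arm2 : 'I_3 := @Ordinal 3 2 isT.

Definition wall_dart (d : ('I_n.+1 * 'I_n.+1) * 'I_3) : ('I_n.+1 * 'I_n.+1) * 'I_3 :=
  let: (h, h', i) := d in
  if i == ord0 then ((h, ord_pred h'), arm1)
  else if i == arm1 then ((h, ordS h'), ord0) else ((h', h), i).

Lemma wall_dartK : involutive wall_dart.
Proof.
move=> [[h h'] [[|[|[|i]]] i3]] //=; rewrite /wall_dart /=.
- by rewrite ord_predK; congr (_, _); apply: val_inj.
- by rewrite ordSK; congr (_, _); apply: val_inj.
Qed.

(* The h-th row is the cycle of the copies (h, h'); the third arms join any two rows. *)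
Definition wall := glued_megastars s.+1 wall_dartK.

Definition wall_row h : pred wall := [pred x : wall | x.1.1 == h].

Lemma wall_row_centre h h' p : connect (adj_in (wall_row h)) ((h, h'), None) ((h, h'), p).
Proof.
case: p => [[i [j js]]|]; last exact: connect0.
elim: j js => [|j IH] js.
  by apply: connect1; rewrite /adj_in /= /glued_adj /wall_row /= !eqxx.
apply: connect_trans (IH (ltnW js)) (connect1 _).
by rewrite /adj_in /= /glued_adj /wall_row /= !eqxx.
Qed.

Lemma wall_row_next h h' :
  connect (adj_in (wall_row h)) ((h, h'), None) ((h, ordS h'), None).
Proof.
apply: connect_trans (wall_row_centre h h' (Some (arm1, ord_max))) _.
rewrite connect_adj_in_sym.
apply: connect_trans (wall_row_centre h (ordS h') (Some (ord0, ord_max))) _.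
rewrite connect_adj_in_sym; apply: connect1.
by rewrite /adj_in /= /glued_adj /wall_row /= !eqxx /= andbT andbF; apply/eqP=> -[].
Qed.

Lemma wall_row_connected h : connected_on (wall_row h).
Proof.
have from0 k (kn : k < n.+1) :
    connect (adj_in (wall_row h)) ((h, ord0), None) ((h, Ordinal kn), None).
  elim: k kn => [|k IH] kn.
    by rewrite (_ : Ordinal kn = ord0) ?connect0 //; apply: val_inj.
  apply: connect_trans (IH (ltnW kn)) _.
  rewrite (_ : Ordinal kn = ordS (Ordinal (ltnW kn))); first exact: wall_row_next.
  by apply: val_inj; rewrite /= modn_small.
have from h' p : connect (adj_in (wall_row h)) ((h, ord0), None) ((h, h'), p).
  by apply: connect_trans (wall_row_centre _ _ _); case: h' => k kn; apply: from0.
move=> [[h1 x] p] [[h2 y] q]; rewrite /wall_row /= => /eqP -> /eqP ->.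
by apply: connect_trans (from y q); rewrite connect_adj_in_sym.
Qed.

Definition wall_port (h h' : 'I_n.+1) : wall := ((h, h'), Some (arm2, ord_max)).

Lemma wall_port_adj h h' : h != h' -> adj (wall_port h h') (wall_port h' h).
Proof.
by move=> hh'; rewrite /= /glued_adj /= !eqxx !xpair_eqE (negPf hh') /=.
Qed.

Lemma wall_connected : connected wall.
Proof.
split; first by apply/card_gt0P; exists ((ord0, ord0), None).
have in_row (x y : wall) : x.1.1 = y.1.1 -> connect (@adj wall) x y.
  by move=> xy; apply/connect_adj_in/(wall_row_connected (h := y.1.1)); apply/eqP.
move=> x y; have [|xy] := eqVneq x.1.1 y.1.1; first exact: in_row.
apply: connect_trans (in_row x (wall_port x.1.1 y.1.1) erefl) _.
exact: connect_trans (connect1 (wall_port_adj xy)) (in_row (wall_port _ _) y erefl).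
Qed.

Lemma wall_minor_model :
  @minor_model (complete_graph n.+1) wall (fun h => [set x | wall_row h x]).
Proof.
split.
- by move=> h; apply/set0Pn; exists ((h, ord0), None); rewrite inE /wall_row /=.
- by move=> h h' x; rewrite !inE => /eqP <- /eqP.
- by move=> h; apply: eq_connected_on (@wall_row_connected h) => x; rewrite inE.
- move=> h h' hh'; exists (wall_port h h'), (wall_port h' h).
  by rewrite !inE /wall_row /= !eqxx; split=> //; apply: wall_port_adj.
Qed.

Lemma wall_treewidth : n <= treewidth wall.
Proof.
exact: leq_trans (complete_graph_treewidth n) (treewidth_minor wall_minor_model).
Qed.

End Wall.

Lemma Wtw_ge_tree (F : sgraph) : is_tree F -> ~ subtree_of_M3 F -> Wtw_ge F 2.
Proof.
move=> treeF notM3 Phi [_ [k defPhi]]; rewrite ltnNge; apply/negP=> Phi1.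
have KF : models (complete_graph (maxn k #|F|).+1) Phi.
  apply/defPhi; first exact: complete_graph_connected.
    by apply: leq_trans (complete_graph_treewidth _); apply: leq_maxl.
  by apply: complete_graph_contains; rewrite leqW // leq_maxr.
have [f [f_inj f_adj]] : contains (wall k #|F|) F.
  apply/defPhi; [exact: wall_connected | exact: wall_treewidth |].
  by apply: one_variable_models KF; rewrite ?card_ord.
apply: notM3; split=> //.
by apply: glued_megastars_contains f_inj f_adj (leqnSn _); case: treeF.
Qed.

Theorem theorem7 :
  (forall (F : sgraph) (F0 : {set F}), is_core F0 -> Wtw_ge F #|F0|) /\
  (forall F : sgraph, connected F -> ~ subtree_of_M3 F ->
     Wtw_ge F (treewidth F + 1)).
Proof.
split=> [|F conF notM3]; first exact: Wtw_ge_core.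
move=> Phi defPhi; have [F0 coreF0] := core_exists F.
have := treewidth_core coreF0; have [F00|F03] := core_card coreF0 => twF.
  rewrite F00 in coreF0 twF.
  have treeF : is_tree F by split=> //; apply: empty_core_acyclic.
  by apply: leq_trans (Wtw_ge_tree treeF notM3 defPhi); rewrite cards0 in twF; lia.
by apply: leq_trans (Wtw_ge_core coreF0 defPhi); lia.
Qed.
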